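(* Let $K$ and $N$ be positive integers and let $M$ be an integer with $0\le M\le N$. Put $$R^*=\frac{K-KM/N}{1+KM/N}-\frac{\binom{K-\min\{K,N\}}{KM/N+1}}{\binom{K}{KM/N}},\qquad F^*=\binom{K}{KM/N}.$$ (1) Every symmetric uncoded caching scheme with $K$ users, $N$ files and cache size $M$ (and any subpacketization level $F$) has rate $R\ge R^*$. (2) Suppose in addition that $KM/N$ is an integer and $\frac{M}{N}\le\frac{\min\{K,N\}}{K}$. Then for every positive integer $F$, there exists a symmetric uncoded caching scheme with $K$ users, $N$ files, cache size $M$, subpacketization level $F$ and rate $R=R^*$ if and only if $F\equiv 0\pmod{F^*}$.
   Context: Let $K,N,F$ be positive integers and $M$ an integer with $0\le M\le N$; write $[m]=\{1,\dots,m\}$. Binomial coefficients $\binom{m}{k}$ with $k>m\ge 0$ are $0$. Uncoded caching scheme with $K$ users, $N$ files, cache size $M$ and subpacketization level $F$: there are $N$ files $W_1,\dots,W_N$, and each file $W_i$ is partitioned into $F$ subfiles $W_{i,1},\dots,W_{i,F}$ of equal length. The $NF$ subfiles are arbitrary (independent) vectors over $\mathbb{F}_2$ of a common length $\ge 1$. The scheme has two phases. Placement phase: each user $u\in[K]$ stores (caches) exactly $MF$ of the $NF$ subfiles $W_{i,j}$. The placement is fixed before demands are known. Delivery phase: each user $u\in[K]$ requests one file $W_{d_u}$, where $d=(d_1,\dots,d_K)\in[N]^K$ is an arbitrary demand. Knowing $d$, the server broadcasts to all users a number of transmissions, each being a linear combination of the subfiles $W_{i,j}$ with coefficients in $\mathbb{F}_2$.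 The demand is met if every user $u$ can recover all subfiles of $W_{d_u}$ from the transmissions and the subfiles in its cache (for all values of the subfiles). The rate $R$ of the scheme is the smallest nonnegative real number such that every demand can be met by $RF$ transmissions; that is, $RF$ is the maximum over demands $d\in[N]^K$ of the minimum number of transmissions with which $d$ can be met. The ratio $M/N$ is called the user's cache rate. The scheme is symmetric if (i) whenever a user caches $W_{i,j}$, it also caches $W_{k,j}$ for every $k\in[N]$; and (ii) every subfile $W_{i,j}$ is cached by the same number of users. (In a symmetric scheme this number is necessarily $KM/N$, so $KM/N$ is an integer whenever such a scheme exists.) *)

(* Defs.v *)
From mathcomp Require Import all_boot all_order all_algebra.

Set Implicit Arguments.
Unset Strict Implicit.
Unset Printing Implicit Defensive.

Import GRing.Theory.
Local Open Scope ring_scope.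

(* The subfile W_{i,j} is addressed by (i, j); it is a vector of L bits. *)
Definition library (N F L : nat) := {ffun 'I_N * 'I_F -> 'rV['F_2]_L}.

(* T linear combinations of the subfiles, given by their coefficients. *)
Definition coding (N F T : nat) := {ffun 'I_T -> {ffun 'I_N * 'I_F -> 'F_2}}.

Definition broadcast (N F L T : nat) (C : coding N F T) (W : library N F L) :
    {ffun 'I_T -> 'rV['F_2]_L} :=
  [ffun t => \sum_(p : 'I_N * 'I_F) C t p *: W p].

Definition cached (N F L : nat) (S : {set 'I_N * 'I_F}) (W : library N F L) :
    {ffun {p : 'I_N * 'I_F | p \in S} -> 'rV['F_2]_L} :=
  [ffun p => W (val p)].

Definition file (N F L : nat) (i : 'I_N) (W : library N F L) :
    {ffun 'I_F -> 'rV['F_2]_L} :=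
  [ffun j => W (i, j)].

(* The decoder dec is an arbitrary (not necessarily linear) function, which
   may depend on the user, the demand and the coding, but not on W. *)
Definition recovers (N F L T : nat) (C : coding N F T)
    (S : {set 'I_N * 'I_F}) (i : 'I_N) : bool :=
  [exists dec : {ffun {ffun 'I_T -> 'rV['F_2]_L} *
                      {ffun {p : 'I_N * 'I_F | p \in S} -> 'rV['F_2]_L} ->
                      {ffun 'I_F -> 'rV['F_2]_L}},
   forall W : library N F L,
     dec (broadcast C W, cached S W) == file i W].

(* The delivery phase is not part of the record: the rate below is defined
   with an optimal delivery for each demand. *)
Record scheme (K N M F : nat) := Scheme {
  cache :> 'I_K -> {set 'I_N * 'I_F};
  card_cache : forall u, #|cache u| = (M * F)%N
}.

Definition symmetric_scheme (K N M F : nat) (Z : scheme K N M F) : Prop :=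
  (forall (u : 'I_K) (i : 'I_N) (j : 'I_F),
     (i, j) \in Z u -> forall k : 'I_N, (k, j) \in Z u) /\
  (exists t : nat, forall (i : 'I_N) (j : 'I_F),
     #|[set u : 'I_K | (i, j) \in Z u]| = t).

Definition demand (K N : nat) := {ffun 'I_K -> 'I_N}.

Definition can_be_met (K N M F : nat) (L : nat) (Z : scheme K N M F)
    (d : demand K N) (T : nat) : bool :=
  [exists C : coding N F T, forall u : 'I_K, recovers L C (Z u) (d u)].

Lemma can_be_met_exists (K N M F L : nat) (Z : scheme K N M F)
    (d : demand K N) : exists T, can_be_met L Z d T.
Proof.
exists #|{: 'I_N * 'I_F}|; apply/existsP.
exists [ffun t => [ffun p => (enum_val t == p)%:R]].
apply/forallP => u; apply/existsP.
exists [ffun x : {ffun 'I_#|{: 'I_N * 'I_F}| -> 'rV_L} * _ =>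
  [ffun j => x.1 (enum_rank (d u, j))]].
apply/forallP => W; apply/eqP/ffunP => j; rewrite !ffunE /=.
rewrite (bigD1 (d u, j)) //= !ffunE enum_rankK eqxx scale1r big1 ?addr0 //.
by move=> p /negPf np; rewrite !ffunE eq_sym np scale0r.
Qed.

Definition min_transmissions (K N M F L : nat) (Z : scheme K N M F)
    (d : demand K N) : nat :=
  ex_minn (can_be_met_exists L Z d).

Definition rate (K N M F L : nat) (Z : scheme K N M F) : rat :=
  (\max_(d : demand K N) min_transmissions L Z d)%:R / F%:R.

(* Used only where N divides K * M; the floor division is then exact. *)
Definition Rstar (K N M : nat) : rat :=
  let t : rat := K%:R * M%:R / N%:R in
  (K%:R - t) / (1 + t)
    - 'C(K - minn K N, (K * M %/ N).+1)%:R / 'C(K, K * M %/ N)%:R.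

Definition Fstar (K N M : nat) : nat := 'C(K, K * M %/ N).

(* Main.v *)
(** Let t = KM/N, m = min(K,N), let A_j be the set of the t users caching the
    subfiles of index j, and f(S) the number of j with A_j disjoint from S.
    For an ordering s of the users whose first m users demand distinct files,
    the subfiles of the k-th demanded file that none of the first k users
    caches can all be decoded in turn from the transmissions, so at least
    sum_(k=1)^m f({s_1, ..., s_k}) transmissions are needed; averaging over s
    gives R^*.  If R = R^* the bound is the same for all s, and swapping two
    consecutive users shows that f(S) depends only on #|S| as long as
    #|S| <= m.  As t <= m, inclusion-exclusion then shows that every t-set of
    users is A_j for equally many j, whence 'C(K, t) divides F.

    Conversely, if F = q 'C(K, t), let every t-set be A_j for q indices j.  For
    every (t+1)-set B of users send the sum over u in B of the subfile wanted
    by u and cached by B \ u, but only for the B containing a leader, where one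
    leader is chosen among the users demanding a given file: the other sums are
    linear combinations of these. *)

Require Import Defs.
From mathcomp Require Import all_boot all_order all_algebra.
From mathcomp Require Import fingroup perm.
From mathcomp Require Import zify.

Set Implicit Arguments.
Unset Strict Implicit.
Unset Printing Implicit Defensive.

Import GRing.Theory Num.Theory.
Local Open Scope nat_scope.

(** * Permutations acting on sets *)

Section Sets.
Variable T : finType.
Implicit Types (A B P S : {set T}) (s : {perm T}).

Lemma perm_imset A B : #|A| = #|B| -> exists s, s @: A = B.
Proof.
(* [e C] lists [C] and then its complement; the permutation sends each entry of [e A] to the entry
   of [e B] in the same place. *)
move=> eqAB; pose e (C : {set T}) := enum C ++ enum (~: C).
have e_uniq C : uniq (e C).
  rewrite cat_uniq !enum_uniq andbT /=; apply/hasPn => x.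
  by rewrite !mem_enum inE.
have e_mem C x : x \in e C by rewrite mem_cat !mem_enum inE orbN.
have e_size C : size (e C) = #|T| by rewrite size_cat -!cardE cardsC.
have f_inj : injective (fun x => nth x (e B) (index x (e A))).
  move=> x y /eqP.
  have ix z : index z (e A) < size (e B) by rewrite e_size -(e_size A) index_mem.
  rewrite (set_nth_default x y) // nth_uniq // => /eqP /(congr1 (nth x (e A))).
  by rewrite !nth_index.
exists (perm f_inj); apply/eqP.
rewrite eqEcard card_imset ?eqAB ?leqnn ?andbT; last exact: perm_inj.
apply/subsetP => _ /imsetP[x xA ->]; rewrite permE.
have xe : x \in enum A by rewrite mem_enum.
have lt_x : index x (enum A) < size (enum B) by rewrite -cardE -eqAB cardE index_mem.
by rewrite index_cat xe nth_cat lt_x -mem_enum mem_nth.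
Qed.

Lemma imset_permM s1 s2 S : (s1 * s2)%g @: S = s2 @: (s1 @: S).
Proof. by rewrite -imset_comp; apply: eq_imset => x /=; rewrite permM. Qed.

Lemma imset_tperm x y S : (x \in S) = (y \in S) -> tperm x y @: S = S.
Proof.
move=> xyS; apply/eqP; rewrite eqEcard card_imset ?leqnn ?andbT; last exact: perm_inj.
apply/subsetP => _ /imsetP[z zS ->].
by case: tpermP => [zx|zy|//]; [rewrite -xyS -zx|rewrite xyS -zy].
Qed.

Lemma disjoint_imset_perm s A B :
  [disjoint s @: A & s @: B] = [disjoint A & B].
Proof.
rewrite -!setI_eq0 -imsetI; last by move=> x y _ _; apply: perm_inj.
by rewrite imset_eq0.
Qed.

(** Double counting of the pairs of a set [B] of size [#|A|] and a permutation [s] with [B] disjoint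
    from [s @: P]. By [perm_imset] every such [B] occurs with equally many [s]. *)
Lemma card_perm_disjoint A P :
  #|[set s : {perm T} | [disjoint A & s @: P]]| * 'C(#|T|, #|A|) =
  #|T|`! * 'C(#|T| - #|P|, #|A|).
Proof.
have cA B : #|B| == #|A| ->
    #|[set s : {perm T} | [disjoint B & s @: P]]| = #|[set s : {perm T} | [disjoint A & s @: P]]|.
  move=> /eqP/perm_imset[r rB]; rewrite -(card_imset _ (mulIg r)).
  apply: eq_card => s; rewrite [RHS]inE; apply/imsetP/idP.
    by case=> s' + ->; rewrite inE -rB imset_permM disjoint_imset_perm.
  move=> As; exists (s * r^-1)%g; last by rewrite mulgKV.
  by rewrite inE -(disjoint_imset_perm r) rB -imset_permM mulgKV.
have -> : #|[set s : {perm T} | [disjoint A & s @: P]]| * 'C(#|T|, #|A|) =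
    \sum_(B : {set T} | #|B| == #|A|) #|[set s : {perm T} | [disjoint B & s @: P]]|.
  rewrite (eq_bigr _ cA) sum_nat_const mulnC; congr (_ * _).
  by rewrite -card_draws; apply: eq_card => B; rewrite inE.
under eq_bigr => B _ do rewrite -sum1dep_card.
rewrite (exchange_big_dep predT) //=.
rewrite (eq_bigr (fun=> 'C(#|T| - #|P|, #|A|))).
  rewrite sum_nat_const; congr (_ * _).
  rewrite -[LHS]cardsT -(cardsT T) -card_perm -cardsE; apply: eq_card => s.
  by rewrite !inE /perm_on; apply/esym/subsetP => x _; rewrite inE.
move=> s _; rewrite -(card_imset P (@perm_inj _ s)) sum1dep_card.
have <- : #|~: (s @: P)| = #|T| - #|s @: P|.
  by rewrite -(cardsC (s @: P)) addKn.
by rewrite -cards_draws; apply: eq_card => B; rewrite !inE -disjoints_subset andbC.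
Qed.

End Sets.

(** Pascal's rule, iterated [m] times. *)
Lemma sum_bin_pred K m t :
  m <= K -> \sum_(k < m) 'C(K - k.+1, t) + 'C(K - m, t.+1) = 'C(K, t.+1).
Proof.
elim: m => [|m IHm] m_le; first by rewrite big_ord0 subn0.
rewrite big_ord_recr /= -addnA -IHm ?(ltnW m_le) //; congr (_ + _).
have -> : K - m = (K - m.+1).+1 by lia.
by rewrite binS addnC.
Qed.

(** * Averaging over orderings of the users, and the case of a constant bound *)

Section Placement.
Variables (K : nat) (J : finType) (A : J -> {set 'I_K}).
Implicit Types (S B : {set 'I_K}) (s : {perm 'I_K}).

Definition first k : {set 'I_K} := [set x : 'I_K | x < k].

Lemma card_first k : k <= K -> #|first k| = k.
Proof.
move=> k_le; rewrite -[RHS]card_ord.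
have w_inj : injective (widen_ord k_le) by move=> x y /(congr1 val) /= /val_inj.
rewrite -(card_imset _ w_inj).
apply: eq_card => x; rewrite inE; apply/idP/imsetP => [xk|[y _ ->]].
  by exists (Ordinal xk) => //; apply: val_inj.
by rewrite /= ltn_ord.
Qed.

Definition avoid S := #|[set j | [disjoint A j & S]]|.

(** The users are ordered as [s 0], [s 1], and so on. This is the size of an acyclic set in the
    side-information graph of index coding, when the first [m] users demand distinct files. *)
Definition acyclic_bound m s := \sum_(k < m) avoid (s @: first k.+1).

Lemma sum_acyclic_bound m t : (forall j, #|A j| = t) -> m <= K ->
  (\sum_s acyclic_bound m s) * 'C(K, t) =
  K`! * (#|J| * ('C(K, t.+1) - 'C(K - m, t.+1))).
Proof.
move=> cA m_le; rewrite -(sum_bin_pred t m_le) addnK /acyclic_bound.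
rewrite exchange_big /= big_distrl !big_distrr /=; apply: eq_bigr => k _.
rewrite /avoid; under eq_bigr => s _ do rewrite -sum1dep_card.
rewrite (exchange_big_dep predT) //= big_distrl /=.
rewrite mulnCA -sum_nat_const; apply: eq_bigr => j _.
have := card_perm_disjoint (A j) (first k.+1).
by rewrite sum1dep_card card_ord cA card_first // (leq_trans (ltn_ord k)).
Qed.

(** Two orderings that differ by swapping the users in places [#|S|.-1] and [#|S|] have the same
    initial segments, except for the one of length [#|S|]. Equality of their bounds thus isolates
    that single term. *)
Lemma avoid_tperm m b x y S :
    (forall s, acyclic_bound m s = b) -> #|S| <= m ->
  avoid (tperm x y @: S) = avoid S.
Proof.
move=> cb S_le.
wlog [xS yS] : x y / x \in S /\ y \notin S.
  move=> H; case xS: (x \in S); case yS: (y \in S).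
  - by rewrite imset_tperm // xS yS.
  - by apply: H; rewrite xS yS.
  - by rewrite tpermC; apply: H; rewrite xS yS.
  - by rewrite imset_tperm // xS yS.
have S_gt0 : 0 < #|S| by apply/card_gt0P; exists x.
have S_lt : #|S| < K.
  have /proper_card : S \proper [set: 'I_K].
    by rewrite properT; apply/eqP => ST; rewrite ST inE in yS.
  by rewrite cardsT card_ord.
have [s sS] : exists s, s @: first #|S| = S.
  by apply: perm_imset; rewrite card_first // ltnW.
have pS_lt : #|S|.-1 < K by lia.
pose a := Ordinal pS_lt; pose c := Ordinal S_lt.
have mem_s z : (s^-1%g z < #|S|) = (z \in S).
  by rewrite -{2}sS -[z in RHS](permKV s) mem_imset ?inE //; exact: perm_inj.
(* r lists S first, with x in the last place of S and y just after. *)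
pose r := (tperm a (s^-1 x) * (tperm c (s^-1 y) * s))%g.
have rE k : (tperm a c * r)%g @: first k = tperm x y @: (r @: first k).
  suff e : (tperm a c * r = r * tperm x y)%g by rewrite e imset_permM.
  apply/permP => z.
  have ra : r a = x.
    rewrite !permM tpermL tpermD ?permKV //; apply/eqP.
      by move/(congr1 val) => /= e; have := mem_s x; rewrite xS -e ltnn.
    by move=> /perm_inj e; rewrite e xS in yS.
  have rc : r c = y.
    rewrite !permM (tpermD (z := c)) ?tpermL ?permKV //.
      by apply/eqP => /(congr1 val) /= e; have := ltn_predL #|S|; rewrite S_gt0 e ltnn.
    by apply/eqP => /(congr1 val) /= e; have := mem_s x; rewrite xS e ltnn.
  rewrite permM [RHS]permM; case: (tpermP a c z) => [->|->|za zc].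
  - by rewrite rc ra tpermL.
  - by rewrite ra rc tpermR.
  - by rewrite tpermD //; apply/eqP => e; [apply: za|apply: zc];
      apply: (@perm_inj _ r); rewrite -e.
have rS : r @: first #|S| = S.
  rewrite !imset_permM (imset_tperm (S := first _)); last first.
    by rewrite !inE mem_s xS ltn_predL.
  by rewrite imset_tperm // !inE mem_s (negPf yS) ltnn.
have := cb (tperm a c * r)%g; rewrite -(cb r) /acyclic_bound.
have kS : #|S|.-1 < m by rewrite prednK.
rewrite (bigD1 (Ordinal kS)) //= [in RHS](bigD1 (Ordinal kS)) //= prednK //.
rewrite rE rS (eq_bigr (fun k : 'I_m => avoid (r @: first k.+1))) => [/addIn //|].
move=> k /eqP kn; rewrite imset_permM imset_tperm // !inE /=.
have : (k : nat) <> #|S|.-1 by move=> e; apply: kn; apply: val_inj.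
by move: S_gt0; case: #|S| => [|n] //= _; lia.
Qed.

Lemma avoid_perm m b s S :
    (forall r, acyclic_bound m r = b) -> #|S| <= m ->
  avoid (s @: S) = avoid S.
Proof.
move=> cb; case: (prod_tpermP s) => ts -> _.
elim: ts S => [|p ts IH] S S_le.
  by rewrite big_nil -[in RHS](imset_id S); congr avoid; apply: eq_imset => x; rewrite perm1.
rewrite big_cons imset_permM IH ?(avoid_tperm _ _ cb) //.
by rewrite card_imset //; exact: perm_inj.
Qed.

Definition cover_avoid B S := #|[set j | (B \subset A j) && [disjoint A j & S]]|.

Lemma cover_avoidU1 x B S : x \notin B ->
  cover_avoid B S = cover_avoid (x |: B) S + cover_avoid B (x |: S).
Proof.
move=> xB; rewrite /cover_avoid -(cardsID [set j | x \in A j]); congr (_ + _).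
  by apply: eq_card => j; rewrite !inE subUset sub1set andbC andbA.
apply: eq_card => j; rewrite !inE !(disjoint_sym (A j)) !disjoints_subset.
by rewrite subUset sub1set inE andbCA.
Qed.

(** Inclusion-exclusion as an induction on [#|B|]: [cover_avoidU1] drops an element of [B] or moves
    it to [S]. Neither increases [#|B| + #|S|], and [avoid_perm] settles empty [B]. *)
Lemma cover_avoid_perm m b s B S :
    (forall r, acyclic_bound m r = b) -> #|B| + #|S| <= m ->
  cover_avoid (s @: B) (s @: S) = cover_avoid B S.
Proof.
move=> cb; move: {2}#|B| (erefl #|B|) => n; elim: n B S => [|n IH] B S.
  move/eqP; rewrite cards_eq0 => /eqP-> BS; rewrite imset0.
  have E C : cover_avoid set0 C = avoid C.
    by apply: eq_card => j; rewrite !inE sub0set.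
  by rewrite !E (avoid_perm _ cb) //; move: BS; rewrite cards0.
move=> cB BS; have /card_gt0P[x xB] : 0 < #|B| by rewrite cB.
have cBx : #|B :\ x| = n by have := cardsD1 x B; rewrite xB cB => -[].
have sD1 : s @: (B :\ x) = (s @: B) :\ s x.
  apply/setP => y; rewrite -(permKV s y) !inE !mem_imset ?inE; try exact: perm_inj.
  by rewrite (inj_eq perm_inj).
have BxS : #|B :\ x| + #|x |: S| <= m.
  rewrite cBx (leq_trans _ BS) // cB addSnnS leq_add2l.
  by rewrite cardsU1; case: (x \notin S).
have BxS' : #|B :\ x| + #|S| <= m by rewrite cBx (leq_trans _ BS) // cB leq_add2r.
have := cover_avoidU1 S (negbT (setD11 x B)); rewrite setD1K // -IH //.
rewrite -[in X in _ = _ + X -> _]IH //.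
have := cover_avoidU1 (s @: S) (negbT (setD11 (s x) (s @: B))).
by rewrite setD1K ?imset_f // -sD1 -imsetU1 => -> /addIn.
Qed.

(** For a [t]-set [B], [cover_avoid B set0] counts the [j] with [A j = B], since [A j] also has size
    [t]. So all fibres of [A] over [t]-sets are equally large. *)
Lemma bin_dvd_of_const_bound m b t : (forall j, #|A j| = t) -> t <= m ->
  (forall s, acyclic_bound m s = b) -> 'C(K, t) %| #|J|.
Proof.
move=> cA t_le cb.
have [B0 cB0|noB] := pickP [pred B : {set 'I_K} | #|B| == t]; last first.
  (* If there is no [t]-set, then [J] is empty. *)
  rewrite (eq_card0 (A := J)) ?dvdn0 // => j.
  by have := noB (A j); rewrite /= cA eqxx.
suff -> : #|J| = 'C(K, t) * cover_avoid B0 set0 by apply: dvdn_mulr.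
rewrite -{1}[K]card_ord -card_draws -sum_nat_const.
rewrite -sum1_card (partition_big A (mem [set B : {set 'I_K} | #|B| == t])) /=; last first.
  by move=> j _; rewrite inE cA.
apply: eq_bigr => B; rewrite inE => /eqP cB.
have [s sB] : exists s, s @: B0 = B by apply: perm_imset; rewrite cB; apply/eqP.
rewrite -(@cover_avoid_perm m b s B0) ?cards0 ?addn0 //; last by rewrite (eqP cB0).
rewrite sum1dep_card sB imset0; apply: eq_card => j; rewrite !inE.
rewrite -setI_eq0 setI0 eqxx andbT.
by rewrite eq_sym eqEcard cB cA leqnn andbT.
Qed.

End Placement.

(** * Decodability as injectivity *)

Section Recovery.
Local Open Scope ring_scope.
Variables (N F L T : nat) (C : coding N F T).
Variables (S : {set 'I_N * 'I_F}) (i : 'I_N).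

Lemma recoversP :
  reflect (forall W W' : library N F L,
      broadcast C W = broadcast C W' -> cached S W = cached S W' ->
      file i W = file i W')
    (recovers L C S i).
Proof.
apply: (iffP existsP) => [[dec /forallP decP] W W' eqb eqc|sep].
  by rewrite -(eqP (decP W)) -(eqP (decP W')) eqb eqc.
(* Decode by choosing any library that explains the observation; the value 0 is for observations
   that never occur. *)
exists [ffun x => if [pick W : library N F L | (broadcast C W, cached S W) == x]
  is Some W then file i W else [ffun=> 0]].
apply/forallP => W; rewrite ffunE; case: pickP => [W' /eqP[eqb eqc]|/(_ W)].
  by apply/eqP/sep.
by rewrite eqxx.
Qed.

(** What a user observes and what it wants are linear in the library, so two libraries can be
    replaced by their difference. *)
Lemma recovers_ker :
  (forall W : library N F L, broadcast C W =1 (fun=> 0) ->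
     (forall p, p \in S -> W p = 0) -> forall j, W (i, j) = 0) ->
  recovers L C S i.
Proof.
move=> ker0; apply/recoversP => W W' eqb eqc; apply/ffunP => j; rewrite !ffunE.
apply/eqP; rewrite -subr_eq0; apply/eqP.
have := ker0 [ffun p => W p - W' p]; rewrite /broadcast => /(_ _ _ j).
rewrite ffunE; apply=> [t|p pS].
  move/ffunP/(_ t): eqb; rewrite !ffunE => eqt.
  rewrite -[RHS](subrr (\sum_p C t p *: W p)) {2}eqt -sumrB.
  by apply: eq_bigr => p _; rewrite ffunE scalerBr.
by move/ffunP/(_ (exist _ p pS)): eqc; rewrite !ffunE /= => ->; rewrite subrr.
Qed.

End Recovery.

(** * The lower bound from one ordering *)

Section Converse.
Variables (K N M F L T m : nat) (Z : scheme K N M F) (A : 'I_F -> {set 'I_K}).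
Hypothesis ZA : forall u i j, ((i, j) \in Z u) = (u \in A j).

(** Among libraries vanishing outside [Q], the transmissions alone determine the library. There are
    [2 ^ (L * #|Q|)] such libraries and [2 ^ (L * T)] possible broadcasts. *)
Lemma acyclic_bound_leq (s : {perm 'I_K}) (d : demand K N) :
    0 < L -> m <= K -> m <= N ->
    (forall x : 'I_K, x < m -> d (s x) = x :> nat) ->
  can_be_met L Z d T -> acyclic_bound A m s <= T.
Proof.
move=> L_gt0 mK mN ds /existsP[C /forallP rec].
pose Q := [set p : 'I_N * 'I_F |
  (p.1 < m) && [disjoint A p.2 & s @: first K p.1.+1]].
have -> : acyclic_bound A m s = #|Q|.
  rewrite /acyclic_bound.
  rewrite (big_ord_widen N (fun k => avoid A (s @: first K k.+1)) mN).
  rewrite /avoid; under eq_bigr => k _ do rewrite -sum1dep_card.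
  by rewrite pair_big_dep sum1dep_card.
pose e (x : {ffun {p | p \in Q} -> 'rV['F_2]_L}) : library N F L :=
  [ffun p => oapp x 0%R (insub p)].
have eN x p : p \notin Q -> e x p = 0%R by move=> pQ; rewrite ffunE insubN.
have e_inj : injective (fun x => broadcast C (e x)).
  (* Files are decoded in increasing order: file [i] is decoded by user [s a], whose cache contents
     are known by then. *)
  move=> x y eqb; suff exy n (i : 'I_N) j : i < n -> e x (i, j) = e y (i, j).
    apply/ffunP => -[[i j] pQ]; have := exy i.+1 i j (ltnSn i).
    by rewrite !ffunE insubT.
  elim: n i j => // n IH i j; rewrite ltnS => le_in.
  case: (ltnP i m) => [im|mi]; last by rewrite !eN // inE /= ltnNge mi.
  pose a := Ordinal (leq_trans im mK).
  have dsa : d (s a) = i by apply: val_inj; rewrite /= ds.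
  have := rec (s a); rewrite dsa => /recoversP/(_ _ _ eqb) H.
  suff /H/ffunP/(_ j) : cached (Z (s a)) (e x) = cached (Z (s a)) (e y).
    by rewrite ![file _ _ _]ffunE.
  apply/ffunP => -[[i' j'] pZ]; rewrite ![cached _ _ _]ffunE /=.
  case: (ltnP i' i) => [i'i|ii']; first by apply: IH; apply: leq_trans le_in.
  (* As [i <= i'], user [s a] is among the first [i'.+1] users, so what it caches of file [i'] lies
     outside [Q] and is zero. *)
  suff pQ : (i', j') \notin Q by rewrite !eN.
  rewrite inE /= negb_and; apply/orP; right.
  apply/pred0Pn; exists (s a); rewrite /= -(ZA _ i') pZ mem_imset ?inE //.
  exact: perm_inj.
have := leq_card _ e_inj.
by rewrite !card_ffun card_sig card_ord card_mx card_Fp // leq_exp2l // mul1n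
  (ltn_exp2l 0).
Qed.

End Converse.

(** * Redundancy of the sums over sets without a leader *)

Section Boundary.
Local Open Scope ring_scope.
Variables (T I : finType) (V : zmodType).
Hypothesis V2 : forall x : V, x + x = 0.
Implicit Types (P Q : pred T) (g : {set T} -> V) (S B : {set T}).

(** The simplicial coboundary modulo 2, restricted to the vertices in [P]. *)
Definition del P g S := \sum_(u in S | P u) g (S :\ u).

Lemma eq_del P g g' : g =1 g' -> del P g =1 del P g'.
Proof. by move=> eqg S; apply: eq_bigr. Qed.

Lemma del0 P : del P (fun=> 0) =1 fun=> 0.
Proof. by move=> S; apply: big1. Qed.

Lemma del_sum P (J : finType) (R : pred J) (g : J -> {set T} -> V) S :
  del P (fun B => \sum_(i | R i) g i B) S = \sum_(i | R i) del P (g i) S.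
Proof. exact: exchange_big. Qed.

Lemma delC P Q g : del P (del Q g) =1 del Q (del P g).
Proof.
move=> S; rewrite /del (exchange_big_dep (fun v => (v \in S) && Q v)) /=; last first.
  by move=> u v _; rewrite !inE => /andP[/andP[_ ->]].
apply: eq_bigr => v /andP[vS Qv]; apply: eq_big => [u|u _].
  by rewrite !inE vS Qv !andbT andbC eq_sym andbA.
by rewrite !setDDl setUC.
Qed.

(** Two elements can be removed in either order, with the same result, so the terms cancel in pairs
    by [V2]; [R] selects one order of each pair. *)
Lemma del_del P g : del P (del P g) =1 fun=> 0.
Proof.
move=> S; rewrite /del pair_big_dep /=.
pose R (p : T * T) := (enum_rank p.1 < enum_rank p.2)%N.
have RN p : p.1 != p.2 -> ~~ R p = R (p.2, p.1).
  by move=> np; rewrite /R -leqNgt leq_eqVlt (inj_eq val_inj) (inj_eq enum_rank_inj) eq_sym (negPf np).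
have swapK : involutive (fun p : T * T => (p.2, p.1)) by case.
rewrite (bigID R) /= [X in _ + X](reindex_inj (inv_inj swapK)) /=.
rewrite [X in _ + X](eq_big (fun p => (p.1 \in S) && P p.1 && ((p.2 \in S :\ p.1) && P p.2) && R p)
  (fun p => g (S :\ p.1 :\ p.2))) ?V2 // => [[u v] | [u v] _] /=; last by rewrite !setDDl setUC.
rewrite !inE eq_sym; case: (eqVneq u v) => [->|nuv]; first by rewrite !andbF.
rewrite (RN (v, u)) 1?eq_sym //=; congr (_ && _).
exact: andbC.
Qed.

Variables (d : T -> I) (l : I -> T).

Definition dels (s : seq I) g := foldr (fun i => del (fun u => d u == i)) g s.

Lemma dels_sum s (J : finType) (R : pred J) (g : J -> {set T} -> V) S :
  dels s (fun B => \sum_(i | R i) g i B) S = \sum_(i | R i) dels s (g i) S.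
Proof. by elim: s S => //= i s IH S; rewrite (eq_del _ IH) del_sum. Qed.

Lemma dels_del i s g : i \in s ->
  dels s (del (fun u => d u == i) g) =1 fun=> 0.
Proof.
elim: s => //= j s IH; rewrite inE; case: eqP => [<- _|_ /= /IH IHs] S; last first.
  by rewrite (eq_del _ IHs) del0.
have comm B : dels s (del (fun u => d u == i) g) B = del (fun u => d u == i) (dels s g) B.
  by elim: s {IH} B => //= k s IH B; rewrite (eq_del _ IH) delC.
by rewrite (eq_del _ comm) del_del.
Qed.

(** Only elements with demand in [s] are ever removed, so [x] survives in every set of size [c] at
    which [g] is finally evaluated. *)
Lemma dels_vanish c x s g S : d x \notin s -> x \in S -> #|S| = (size s + c)%N ->
  (forall B, #|B| = c -> x \in B -> g B = 0) -> dels s g S = 0.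
Proof.
move=> + + + g0; elim: s S => [|i s IH] S /=; first by move=> _ xS /g0; apply.
rewrite inE negb_or => /andP[dxi dxs] xS cS; apply: big1 => u /andP[uS /eqP du].
apply: IH => //.
  by rewrite !inE xS andbT; apply: contra_neq dxi => ->.
by move: cS; rewrite (cardsD1 u) uS => -[].
Qed.

(** If the element removed for [i] is not [l i], then [l i] is never removed later and the term
    vanishes by [dels_vanish]. What remains is the removal of exactly the leaders. *)
Lemma dels_leaders c s g S : uniq s -> {in s, forall i, d (l i) = i} ->
    {in s, forall i, l i \in S} -> #|S| = (size s + c)%N ->
    (forall B, #|B| = c -> {in s, forall i, l i \in B -> g B = 0}) ->
  dels s g S = g (S :\: [set x in map l s]).
Proof.
elim: s S => [|i s IH] S /=; first by rewrite set_nil setD0.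
move=> /andP[is_ us] dl lS cS g0; have liS := lS i (mem_head i s).
have dli := dl i (mem_head i s).
rewrite {1}/del (bigD1 (l i)) /=; last by rewrite liS dli eqxx.
have cSD u : u \in S -> #|S :\ u| = (size s + c)%N.
  by move=> uS; move: cS; rewrite (cardsD1 u) uS => -[].
rewrite IH ?cSD //; first last.
- by move=> B cB k ks; apply: g0; rewrite ?inE ?ks ?orbT.
- move=> k ks; rewrite !inE lS ?inE ?ks ?orbT // andbT.
  by apply: contraNneq is_ => e; rewrite -dli -e dl // inE ks orbT.
- by move=> k ks; apply: dl; rewrite inE ks orbT.
rewrite big1 ?addr0 => [|u /andP[/andP[uS _] ul]]; last first.
  apply: (@dels_vanish c (l i)); rewrite ?dli ?cSD //.
    by rewrite !inE liS eq_sym ul.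
  by move=> B cB; apply: g0 => //; rewrite mem_head.
by rewrite setDDl set_cons.
Qed.

(* With D_i := del over the users demanding i, the transmissions are
   Y = sum_i D_i w_i; as the D_i commute and square to 0, the product of all
   D_i kills Y, while at B :|: leaders it equals Y B up to terms Y B' where B'
   contains a leader. *)
Lemma transmissions_eq0 c (w : I -> {set T} -> V) :
    (forall u, d (l (d u)) = d u) ->
    (forall B, #|B| = c -> ~~ [disjoint B & [set l i | i in codom d]] ->
       \sum_(u in B) w (d u) (B :\ u) = 0) ->
  forall B, #|B| = c -> \sum_(u in B) w (d u) (B :\ u) = 0.
Proof.
move=> dl; pose Y B := \sum_(u in B) w (d u) (B :\ u).
rewrite -/(Y _) => Y0 B cB; case: (boolP [disjoint B & _]) (Y0 B cB) => [dB _|_ ->//].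
pose s := enum (codom d); pose U := [set x in map l s].
have dls : {in s, forall i, d (l i) = i}.
  by move=> i; rewrite mem_enum => /codomP[u ->].
have us : uniq s by apply: enum_uniq.
have UE : U = [set l i | i in codom d].
  apply/setP => x; rewrite inE; apply/mapP/imsetP.
    by case=> i; rewrite mem_enum => ? ->; exists i.
  by case=> i ? ->; exists i; rewrite ?mem_enum.
have cU : #|U| = size s.
  rewrite cardsE -(size_map l); apply/card_uniqP; rewrite map_inj_in_uniq //.
  by move=> i k /dls {2}<- /dls {2}<- ->.
have cBU : #|B :|: U| = (size s + c)%N.
  by rewrite cardsU (eqP (_ : B :&: U == set0)) ?setI_eq0 ?UE // cards0 subn0 -UE cU cB addnC.
have YE S : Y S = \sum_(i in codom d) del (fun u => d u == i) (w i) S.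
  rewrite /Y (partition_big d (mem (codom d))) /=; last first.
    by move=> u _; apply: codom_f.
  by apply: eq_bigr => i _; apply: eq_bigr => u /andP[_ /eqP->].
have BE : (B :|: U) :\: U = B.
  by rewrite setDUl setDv setU0; apply/setDidPl; rewrite UE.
rewrite -/(Y B) -BE -(@dels_leaders c s Y (B :|: U) us dls) //.
- have dE : dels s Y =1 dels s (fun B =>
     \sum_(i in codom d) del (fun u => d u == i) (w i) B).
    by elim: (s) => //= i s' IH; apply: eq_del.
  by rewrite dE dels_sum big1 // => i id; apply: dels_del; rewrite mem_enum.
- by move=> i si; rewrite !inE map_f ?orbT.
- move=> B' cB' i si lB'; apply: Y0 => //; rewrite -UE.
  by apply/pred0Pn; exists (l i); rewrite /= lB' inE map_f.
Qed.

End Boundary.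

(** * The placement and delivery attaining the bound *)

(** The indices are put in bijection with pairs of a copy number below [q] and a [t]-set; [psi] is
    the inverse on [t]-sets. *)
Lemma uniform_placement K F q t : 0 < F -> F = q * 'C(K, t) ->
  exists (A : 'I_F -> {set 'I_K}) (r : 'I_F -> 'I_q)
         (psi : 'I_q -> {set 'I_K} -> 'I_F),
    [/\ forall j, #|A j| = t, forall j, psi (r j) (A j) = j
      & forall k (S : {set 'I_K}), #|S| = t -> A (psi k S) = S /\ r (psi k S) = k].
Proof.
move=> F_gt0 FE; pose X := ('I_q * {S : {set 'I_K} | #|S| == t})%type.
have cX : #|{: X}| = F.
  rewrite card_prod card_ord card_sig FE; congr (_ * _).
  have := card_draws 'I_K t; rewrite card_ord => <-.
  by apply: eq_card => S; rewrite !inE.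
pose phi (j : 'I_F) : X := enum_val (cast_ord (esym cX) j).
exists (fun j => val (phi j).2), (fun j => (phi j).1), (fun k S =>
  (* The default index is for sets whose size is not [t]. *)
  if insub S is Some S' then cast_ord cX (enum_rank ((k, S') : X))
  else Ordinal F_gt0).
split=> [j|j|k S cS]; first exact/eqP/(valP (phi j).2).
  by rewrite valK -surjective_pairing enum_valK cast_ordKV.
move/eqP in cS; rewrite (insubT (fun S : {set 'I_K} => #|S| == t) cS).
by rewrite /phi cast_ordK enum_rankK.
Qed.

Section Achievability.
Variables (K N M F q t : nat).
Variables (A : 'I_F -> {set 'I_K}) (r : 'I_F -> 'I_q).
Variable psi : 'I_q -> {set 'I_K} -> 'I_F.
Hypothesis cA : forall j, #|A j| = t.
Hypothesis psiK : forall j, psi (r j) (A j) = j.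
Hypothesis Apsi : forall k (S : {set 'I_K}), #|S| = t -> A (psi k S) = S /\ r (psi k S) = k.

Let inj_rA : injective (fun j => (r j, A j)).
Proof. by move=> i j [rij Aij]; rewrite -(psiK i) rij Aij psiK. Qed.

(** It is easier to count the indices that [u] does not cache: they correspond to [q] copies of the
    [t]-subsets of the other users. *)
Lemma card_cached_index (u : 'I_K) : K * #|[set j | u \in A j]| = t * F.
Proof.
have FE : F = q * 'C(K, t).
  rewrite -[LHS]card_ord -(card_imset _ inj_rA).
  have <- : #|setX [set: 'I_q] [set S : {set 'I_K} | #|S| == t]| = q * 'C(K, t).
    by rewrite cardsX cardsT card_ord card_draws card_ord.
  apply: eq_card => -[k S]; rewrite !inE /=; apply/imsetP/eqP.
    by case=> j _ [_ ->].
  by move=> cS; exists (psi k S) => //; have [-> ->] := Apsi k cS.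
have NE : #|[set j | u \notin A j]| = q * 'C(K.-1, t).
  rewrite -(card_imset _ inj_rA).
  have <- : #|setX [set: 'I_q] [set S : {set 'I_K} | S \subset [set~ u] & #|S| == t]|
      = q * 'C(K.-1, t).
    by rewrite cardsX cardsT card_ord cards_draws cardsC1 card_ord.
  apply: eq_card => -[k S]; rewrite !inE /= subsetC sub1set inE; apply/imsetP/andP.
    by case=> j; rewrite inE => uj [_ ->]; rewrite cA.
  case=> uS /eqP cS; have [AE rE] := Apsi k cS.
  by exists (psi k S); rewrite ?inE ?AE ?rE.
have : #|[set j | u \in A j]| + #|[set j | u \notin A j]| = F.
  rewrite -[RHS]card_ord -(cardsC [set j | u \in A j]); congr (_ + _).
  by apply: eq_card => j; rewrite !inE.
(* The case [t > K], where [K - t] truncates, forces [F = 0]. *)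
have tF : (t <= K) || (F == 0).
  by rewrite FE muln_eq0; case: ltnP => // /bin_small ->; rewrite orbT.
rewrite NE; move: (mul_bin_down K t) FE tF.
move: #|_| 'C(K.-1, t) 'C(K, t) => x y z Ky FE /orP[tK|/eqP F0] xF.
  apply/eqP; rewrite -(eqn_add2r (q * (K * y))) [q * (K * y)]mulnCA -mulnDr xF.
  by rewrite [K * (q * y)]mulnCA Ky FE [q * (_ * z)]mulnCA -mulnDl subnKC.
have -> : x = 0 by lia.
by rewrite F0 !muln0.
Qed.

Definition cached_files (u : 'I_K) : {set 'I_N * 'I_F} := [set p | u \in A p.2].

Lemma card_cached_files u : K * M = t * N -> #|cached_files u| = M * F.
Proof.
move=> KM; have -> : cached_files u = setX [set: 'I_N] [set j | u \in A j].
  by apply/setP => p; rewrite !inE.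
have K_gt0 : 0 < K by apply: leq_ltn_trans (ltn_ord u).
apply/eqP; rewrite cardsX cardsT card_ord -(eqn_pmul2l K_gt0).
by rewrite mulnCA card_cached_index [K * _]mulnA KM mulnCA mulnA.
Qed.

Lemma symmetric_of_cached_files (Z : scheme K N M F) :
  (forall u, Z u = cached_files u) -> symmetric_scheme Z.
Proof.
move=> ZE; split=> [u i j + k|]; first by rewrite !ZE !inE.
by exists t => i j; rewrite -(cA j); apply: eq_card => u; rewrite !inE ZE inE.
Qed.

Lemma card_hitting (U : {set 'I_K}) m : #|U| <= m ->
  #|[set B : {set 'I_K} | (#|B| == t.+1) && ~~ [disjoint B & U]]|
    <= 'C(K, t.+1) - 'C(K - m, t.+1).
Proof.
move=> U_le; have cUC : #|~: U| = K - #|U| by rewrite cardsCs setCK card_ord.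
have <- : #|[set B : {set 'I_K} | #|B| == t.+1]| = 'C(K, t.+1).
  by rewrite card_draws card_ord.
rewrite -(cardsID [set B : {set 'I_K} | [disjoint B & U]] [set B : {set 'I_K} | #|B| == t.+1]).
have -> : #|[set B : {set 'I_K} | #|B| == t.+1] :&: [set B : {set 'I_K} | [disjoint B & U]]|
    = 'C(K - #|U|, t.+1).
  rewrite -cUC -cards_draws; apply: eq_card => B.
  by rewrite !inE disjoints_subset andbC.
have -> : [set B : {set 'I_K} | #|B| == t.+1] :\: [set B : {set 'I_K} | [disjoint B & U]]
    = [set B : {set 'I_K} | (#|B| == t.+1) && ~~ [disjoint B & U]].
  by apply/setP => B; rewrite !inE andbC.
by rewrite addnC -addnBA ?leq_addr // leq_bin2l // leq_sub2l.
Qed.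

Lemma min_transmissions_leq L (Z : scheme K N M F) (d : demand K N) :
    0 < K -> (forall u, Z u = cached_files u) ->
  min_transmissions L Z d <= q * ('C(K, t.+1) - 'C(K - minn K N, t.+1)).
Proof.
(* The leader [l i] is some user demanding file [i]; the default is for files that nobody
   demands. *)
move=> K_gt0 ZE; pose l i := odflt (Ordinal K_gt0) [pick u | d u == i].
have dl u : d (l (d u)) = d u.
  by rewrite /l; case: pickP => [v /eqP //|/(_ u)]; rewrite eqxx.
pose U := [set l i | i in codom d].
have cU : #|U| <= minn K N.
  have := max_card (mem U); rewrite card_ord leq_min => -> /=.
  by have := leq_trans (leq_imset_card l _) (max_card (mem (codom d))); rewrite card_ord.
pose hit := [set B : {set 'I_K} | (#|B| == t.+1) && ~~ [disjoint B & U]].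
rewrite /min_transmissions; case: ex_minnP => T _ /(_ (q * #|hit|)) minT.
apply: leq_trans (minT _) _; last by rewrite leq_mul2l card_hitting ?orbT.
have <- : #|{: 'I_q * {B | B \in hit}}| = q * #|hit|.
  by rewrite card_prod card_ord card_sig.
apply/existsP.
(* One transmission for each copy and each [t.+1]-set containing a leader. *)
exists [ffun x => let kB : 'I_q * {B | B \in hit} := enum_val x in
  [ffun p => \sum_(u in val kB.2) (p == (d u, psi kB.1 (val kB.2 :\ u)))%:R]]%R.
apply/forallP => u; apply: recovers_ker => W bW cW j.
have [uj|uj] := boolP (u \in A j); first by rewrite cW // ZE inE.
have F2 (x : 'rV['F_2]_L) : (x + x = 0)%R.
  by rewrite -mulr2n -scaler_nat (_ : 2%:R = 0)%R ?scale0r //; apply: val_inj.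
have cuA : #|u |: A j| = t.+1 by rewrite cardsU1 uj cA.
(* The sum over [u |: A j] vanishes even if this set has no leader. Its term at [u] is the wanted
   subfile; its other terms belong to index sets containing [u], hence are cached by [u]. *)
have := transmissions_eq0 F2 (w := fun i S => W (i, psi (r j) S)) dl _ cuA.
rewrite (bigD1 u) ?setU11 //= setU1K // psiK big1 ?addr0 => [|v /andP[vA vu]].
  apply=> B cB BU; have Bhit : B \in hit by rewrite inE cB eqxx.
  have := bW (enum_rank ((r j, exist _ B Bhit) : 'I_q * {B | B \in hit})).
  rewrite !ffunE enum_rankK /= => {2}<-.
  under [RHS]eq_bigr => p _ do rewrite ffunE scaler_suml.
  rewrite exchange_big /=; apply: eq_bigr => v vB.
  rewrite (bigD1 (d v, psi (r j) (B :\ v))) //= eqxx scale1r big1 ?addr0 //.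
  by move=> p /negPf->; rewrite scale0r.
apply: cW; rewrite ZE inE /=.
have cAv : #|(u |: A j) :\ v| = t.
  by have := cuA; rewrite (cardsD1 v) vA => -[].
by rewrite (Apsi (r j) cAv).1 !inE eq_sym vu eqxx.
Qed.

End Achievability.

(** * From numbers of transmissions to rates *)

Lemma symmetric_index_sets K N M F (Z : scheme K N M F) :
    0 < N -> 0 < F -> symmetric_scheme Z ->
  exists (t : nat) (A : 'I_F -> {set 'I_K}),
    [/\ forall u i j, ((i, j) \in Z u) = (u \in A j),
        forall j, #|A j| = t & K * M = t * N].
Proof.
move=> N_gt0 F_gt0 [Zsym [t Zt]]; pose A j := [set u | (Ordinal N_gt0, j) \in Z u].
have ZA u i j : ((i, j) \in Z u) = (u \in A j).
  by rewrite inE; apply/idP/idP => /Zsym.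
exists t, A; split=> // [j|]; first exact: Zt.
apply/eqP; rewrite -(eqn_pmul2r F_gt0) -mulnA.
(* Double counting of the pairs of a user and a subfile that it caches. *)
have -> : K * (M * F) = \sum_(u : 'I_K) #|Z u|.
  rewrite (eq_bigr (fun=> M * F)) ?sum_nat_const ?card_ord // => u _.
  exact: card_cache.
under eq_bigr => u _ do rewrite -sum1_card.
rewrite (exchange_big_dep predT) //= (eq_bigr (fun=> t)) => [|[i j] _].
  by rewrite sum_nat_const card_prod !card_ord mulnC mulnA.
by rewrite sum1dep_card Zt.
Qed.

Section Rate.
Variables (K N M F L t : nat) (Z : scheme K N M F) (A : 'I_F -> {set 'I_K}).
Hypotheses (N_gt0 : 0 < N) (L_gt0 : 0 < L).
Hypothesis ZA : forall u i j, ((i, j) \in Z u) = (u \in A j).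
Hypothesis cA : forall j, #|A j| = t.

Let Tmax := \max_(d : demand K N) min_transmissions L Z d.
Let m := minn K N.
Let D := 'C(K, t.+1) - 'C(K - m, t.+1).

Lemma acyclic_bound_leq_max s : acyclic_bound A m s <= Tmax.
Proof.
(* User [s x] demands file [x] when [x < N], and file 0 otherwise. *)
pose d : demand K N := [ffun u => insubd (Ordinal N_gt0) (s^-1 u)%g].
apply: leq_trans (leq_bigmax d).
rewrite /min_transmissions; case: ex_minnP => T dT _.
apply: (acyclic_bound_leq (s := s) ZA L_gt0 _ _ _ dT); rewrite ?geq_minl ?geq_minr //.
move=> x; rewrite leq_min => /andP[_ xN].
by rewrite ffunE permK val_insubd xN.
Qed.

Lemma sum_acyclic_bound_min :
  (\sum_(s : {perm 'I_K}) acyclic_bound A m s) * 'C(K, t) = K`! * (F * D).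
Proof. by rewrite (sum_acyclic_bound cA) ?geq_minl // card_ord. Qed.

Let sum_perm_const b : \sum_(s : {perm 'I_K}) b = K`! * b.
Proof. by rewrite sum_nat_const card_Sn. Qed.

(** The maximum is at least the average over the [K]! orderings. *)
Lemma max_transmissions_geq : F * D <= Tmax * 'C(K, t).
Proof.
rewrite -(leq_pmul2l (fact_gt0 K)) -sum_acyclic_bound_min mulnA leq_mul2r.
by rewrite -sum_perm_const leq_sum ?orbT // => s _; apply: acyclic_bound_leq_max.
Qed.

(** If the average equals the upper bound [Tmax], every ordering attains it, so the bound is
    constant. *)
Lemma bin_dvd_of_optimal : t <= m -> F * D = Tmax * 'C(K, t) -> 'C(K, t) %| F.
Proof.
move=> t_le opt; have C_gt0 : 0 < 'C(K, t).
  by rewrite bin_gt0 (leq_trans t_le) ?geq_minl.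
rewrite -[F]card_ord; apply: (bin_dvd_of_const_bound cA t_le (b := Tmax)) => s.
have := sum_acyclic_bound_min; rewrite opt mulnA => /eqP.
rewrite eqn_pmul2r // -sum_perm_const => /eqP eqS.
have := leqif_sum (fun s (_ : true) => leqif_eq (acyclic_bound_leq_max s)).
by move=> [_]; rewrite eqS eqxx => /esym/forallP/(_ s)/eqP.
Qed.

End Rate.

Section RateFormula.
Local Open Scope ring_scope.

(** The first term of [Rstar] is the ratio of ['C(K, t.+1)] to ['C(K, t)]. *)
Lemma Rstar_bin K N M t : (0 < N)%N -> (K * M = t * N)%N -> (t <= K)%N ->
  Rstar K N M = ('C(K, t.+1) - 'C(K - minn K N, t.+1))%N%:R / 'C(K, t)%:R.
Proof.
move=> N_gt0 KM tK; rewrite /Rstar KM mulnK // -natrM KM natrM.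
have N0 : N%:R != 0 :> rat by rewrite pnatr_eq0 -lt0n.
have C0 : 'C(K, t)%:R != 0 :> rat by rewrite pnatr_eq0 -lt0n bin_gt0.
rewrite mulfK // natrB; last by rewrite leq_bin2l // leq_subr.
rewrite [RHS]mulrBl; congr (_ - _); apply/eqP.
rewrite eqr_div // ?nat1r ?pnatr_eq0 // -natrB // -!natrM eqr_nat.
by rewrite -mul_bin_left mulnC.
Qed.

Lemma ratio_leq a b c e : (0 < b)%N -> (0 < e)%N ->
  (a%:R / b%:R <= c%:R / e%:R :> rat) = (a * e <= c * b)%N.
Proof.
move=> b0 e0; rewrite ler_pdivrMr ?ltr0n // mulrAC ler_pdivlMr ?ltr0n //.
by rewrite -!natrM ler_nat.
Qed.

End RateFormula.

Local Open Scope ring_scope.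

Theorem theorem1p3 (K N M L : nat)
    (K_gt0 : (0 < K)%N) (N_gt0 : (0 < N)%N) (M_le_N : (M <= N)%N)
    (L_gt0 : (0 < L)%N) :
  (forall (F : nat) (Z : scheme K N M F),
     (0 < F)%N -> symmetric_scheme Z -> Rstar K N M <= rate L Z) /\
  ((N %| K * M)%N ->
   M%:R / N%:R <= (minn K N)%:R / K%:R :> rat ->
   forall F : nat, (0 < F)%N ->
     ((exists Z : scheme K N M F,
         symmetric_scheme Z /\ rate L Z = Rstar K N M)
      <-> F = 0 %[mod Fstar K N M])).
Proof.
have le_K t : (K * M = t * N)%N -> (t <= K)%N.
  by move=> KM; rewrite -(leq_pmul2r N_gt0) -KM leq_mul2l M_le_N orbT.
split=> [F Z F_gt0 Zsym|dvdN].
  have [t [A [ZA cA KM]]] := symmetric_index_sets N_gt0 F_gt0 Zsym.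
  rewrite (Rstar_bin N_gt0 KM (le_K t KM)) /rate ratio_leq ?bin_gt0 ?le_K //.
  by rewrite mulnC (max_transmissions_geq N_gt0 L_gt0 ZA cA).
rewrite ratio_leq // mulnC => t_le F F_gt0.
have KM := esym (divnK dvdN); set t := (_ %/ _)%N in KM.
have C_gt0 : (0 < 'C(K, t))%N by rewrite bin_gt0 le_K.
have optE (Z : scheme K N M F) : (rate L Z == Rstar K N M) =
    (F * ('C(K, t.+1) - 'C(K - minn K N, t.+1)) ==
     (\max_(d : demand K N) min_transmissions L Z d) * 'C(K, t))%N.
  rewrite (Rstar_bin N_gt0 KM (le_K t KM)) /rate eqr_div ?pnatr_eq0 -?lt0n //.
  by rewrite -!natrM eqr_nat eq_sym [in LHS]mulnC.
(* The assumption on the cache rate becomes [t <= minn K N]. *)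
rewrite KM leq_pmul2r // in t_le.
rewrite mod0n /Fstar -/t; split=> [[Z [Zsym /eqP]]|/eqP].
  have [t' [A [ZA cA KM']]] := symmetric_index_sets N_gt0 F_gt0 Zsym.
  have tt' : t' = t by apply/eqP; rewrite -(eqn_pmul2r N_gt0) -KM -KM'.
  rewrite {}tt' in cA; rewrite optE => /eqP opt.
  by apply/eqP; apply: (bin_dvd_of_optimal N_gt0 L_gt0 ZA cA).
rewrite -/(dvdn _ _) => /dvdnP[q FE].
have [A [r [psi [cA psiK Apsi]]]] := uniform_placement F_gt0 FE.
pose Z := Scheme (fun u => card_cached_files cA psiK Apsi u KM).
have ZE u : Z u = cached_files N A u by [].
exists Z; split; first exact: (symmetric_of_cached_files cA ZE).
apply/eqP; rewrite optE eqn_leq; apply/andP; split.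
  apply: (max_transmissions_geq N_gt0 L_gt0 _ cA) => u i j.
  by rewrite ZE inE.
(* As [F] is [q * 'C(K, t)], the optimum is exactly [q] times the number of sums sent per copy. *)
rewrite [leqRHS](_ : _ = q * ('C(K, t.+1) - 'C(K - minn K N, t.+1)) * 'C(K, t))%N;
  last by rewrite mulnAC -FE.
rewrite leq_pmul2r //; apply/bigmax_leqP => d _.
exact: (min_transmissions_leq cA psiK Apsi).
Qed.
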